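(* Let $T\in B(\mathcal E\otimes F^2(H_n))$ be a weighted right multi-Toeplitz operator. Then $T$ has a formal Fourier representation $$\varphi(W):=\sum_{|\alpha|\ge 1}B_{(\alpha)}\otimes W_\alpha^*+A_{(0)}\otimes I+\sum_{|\alpha|\ge 1}A_{(\alpha)}\otimes W_\alpha ,$$ where $\{A_{(\alpha)}\}_{\alpha\in\mathbb F_n^+}$ (with $A_{(0)}:=A_{(g_0)}$) and $\{B_{(\alpha)}\}_{\alpha\in\mathbb F_n^+\setminus\{g_0\}}$ are some operators in $B(\mathcal E)$, such that $$Tq=\varphi(W)q\qquad\text{for every } q=\sum_{|\alpha|\le k}h_\alpha\otimes e_\alpha,\ \ h_\alpha\in\mathcal E,\ k\in\mathbb N .$$ Moreover, if $T_1,T_2$ are weighted right multi-Toeplitz operators having the same formal Fourier representation, then $T_1=T_2$.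
   Context: Fix integers $n,m\ge1$ and a separable Hilbert space $\mathcal E$. $\mathbb F_n^+$ is the free monoid on generators $g_1,\dots,g_n$ with identity $g_0$; $|\alpha|$ is the word length ($|g_0|=0$). For operators (or indeterminates) and $\alpha=g_{i_1}\cdots g_{i_k}$ put $X_\alpha:=X_{i_1}\cdots X_{i_k}$, $X_{g_0}:=I$. $f=\sum_{\alpha}a_\alpha Z_\alpha$ is a fixed positive regular free holomorphic function: a formal power series in noncommuting indeterminates $Z_1,\dots,Z_n$ with $a_\alpha\ge0$, $a_{g_0}=0$, $a_{g_i}>0$ for $1\le i\le n$, and $\limsup_{k}\big(\sum_{|\alpha|=k}|a_\alpha|^2\big)^{1/2k}<\infty$. Put $b^{(m)}_{g_0}:=1$ and, for $|\alpha|\ge1$, $$b^{(m)}_\alpha:=\sum_{j=1}^{|\alpha|}\ \sum_{\gamma_1\cdots\gamma_j=\alpha,\ |\gamma_i|\ge1}a_{\gamma_1}\cdots a_{\gamma_j}\binom{j+m-1}{m-1}.$$ $F^2(H_n)$ (full Fock space) is the Hilbert space with orthonormal basis $\{e_\alpha\}_{\alpha\in\mathbb F_n^+}$, $e_{g_0}=1$. The weighted left creation operators $W_i\in B(F^2(H_n))$ are $W_ie_\alpha=\sqrt{b^{(m)}_\alpha/b^{(m)}_{g_i\alpha}}\,e_{g_i\alpha}$. For $\omega,\gamma\in\mathbb F_n^+$ write $\omega\ge_r\gamma$ if $\omega=\sigma\gamma$ for some $\sigma\in\mathbb F_n^+$, and $\omega>_r\gamma$ if moreover $\sigma\ne g_0$;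 $\omega,\gamma$ are comparable if $\omega\ge_r\gamma$ or $\gamma>_r\omega$. For comparable $\omega,\gamma$ put $\lambda_{\omega,\gamma}:=\sqrt{b^{(m)}_\omega/b^{(m)}_\gamma}$ if $\omega\ge_r\gamma$ and $\lambda_{\omega,\gamma}:=\sqrt{b^{(m)}_\gamma/b^{(m)}_\omega}$ if $\gamma>_r\omega$. For $T\in B(\mathcal E\otimes F^2(H_n))$ let $C_{\omega,\gamma}\in B(\mathcal E)$ be given by $\langle C_{\omega,\gamma}x,y\rangle=\langle T(x\otimes e_\gamma),y\otimes e_\omega\rangle$. $T$ is a weighted right multi-Toeplitz operator if $\lambda_{\omega g_i,\gamma g_i}C_{\omega g_i,\gamma g_i}=\lambda_{\omega,\gamma}C_{\omega,\gamma}$ for all $i$ and all comparable $\omega,\gamma$, and $C_{\alpha,\beta}=0$ whenever $\alpha,\beta$ are not comparable. The formal Fourier representation of a weighted right multi-Toeplitz $T$ is the formal series $\varphi(W)$ with coefficients determined by $\langle A_{(\alpha)}x,y\rangle=\sqrt{b^{(m)}_\alpha}\langle T(x\otimes1),y\otimes e_\alpha\rangle$ ($\alpha\in\mathbb F_n^+$) and $\langle B_{(\alpha)}x,y\rangle=\sqrt{b^{(m)}_\alpha}\langle T(x\otimes e_\alpha),y\otimes1\rangle$ ($|\alpha|\ge1$), $x,y\in\mathcal E$. The vector $\varphi(W)q$ is $\sum_{|\alpha|\ge1}(B_{(\alpha)}\otimes W_\alpha^* )q+\sum_{\alpha}(A_{(\alpha)}\otimes W_\alpha)q$, where the first sum has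 finitely many nonzero terms and the second converges in $\mathcal E\otimes F^2(H_n)$. *)

(* Defs.v *)
From HB Require Import structures.
From mathcomp Require Import all_boot all_order all_algebra sesquilinear.
From mathcomp Require Import finmap complex.
From mathcomp Require Import all_classical all_reals all_analysis.
From mathcomp.analysis.showcase Require Import summability.

Set Implicit Arguments.
Unset Strict Implicit.
Unset Printing Implicit Defensive.

Import Order.TTheory GRing.Theory Num.Theory Num.Def.

Local Open Scope classical_set_scope.
Local Open Scope complex_scope.
Local Open Scope ring_scope.

(* Complex Hilbert spaces.  The inner product is linear in its first variable
   and conjugate-linear in the second one. *)
HB.mixin Record CompleteNormedModule_isHilbert (R : realType) (H : Type)
    of CompleteNormedModule R[i] H := {
  inner : {dot H for (@conjC R[i])} ;
  sqr_norm_inner : forall x : H, `|x| ^+ 2 = inner x x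
}.

#[short(type="hilbertType")]
HB.structure Definition Hilbert (R : realType) :=
  {H of CompleteNormedModule R[i] H & CompleteNormedModule_isHilbert R H}.

Notation "''[' x , y ]" := (inner x y) : ring_scope.

(* Over a normed space, "bounded" and "continuous" are the same thing for a
   linear map (lemma linear_bounded_continuous). *)
#[short(type="boundedOpType")]
HB.structure Definition BoundedOp (R : realType) (H1 H2 : hilbertType R) :=
  {T of @GRing.Linear R[i] H1 H2 *:%R T & @isContinuous H1 H2 T}.

Notation "''B' ( H1 , H2 )" := (boundedOpType H1 H2)
  (at level 8, format "''B' ( H1 ,  H2 )") : type_scope.
Notation "''B' ( H )" := (boundedOpType H H)
  (at level 8, format "''B' ( H )") : type_scope.

Section BoundedOperators.
Context {R : realType}.
Implicit Types H E F K : hilbertType R.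

HB.instance Definition _ H1 H2 := gen_eqMixin 'B(H1, H2).
HB.instance Definition _ H1 H2 := gen_choiceMixin 'B(H1, H2).

Fact zero_op_continuous H1 H2 : continuous (\0 : H1 -> H2).
Proof. by move=> x; exact: cvg_cst. Qed.

HB.instance Definition _ H1 H2 :=
  @isContinuous.Build H1 H2 (\0 : H1 -> H2) (@zero_op_continuous H1 H2).

Definition zero_op H1 H2 : 'B(H1, H2) := \0 : H1 -> H2.

HB.instance Definition _ H := Continuous.on (idfun : H -> H).

Definition id_op H : 'B(H) := idfun : H -> H.

HB.instance Definition _ H1 H2 H3 (S : 'B(H2, H3)) (T : 'B(H1, H2)) :=
  Continuous.on (S \o T : H1 -> H3).

Definition comp_op H1 H2 H3 (S : 'B(H2, H3)) (T : 'B(H1, H2)) : 'B(H1, H3) :=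
  S \o T : H1 -> H3.

End BoundedOperators.

Section HilbertNotions.
Context {R : realType}.
Implicit Types H E F K : hilbertType R.

Definition separable (T : topologicalType) :=
  exists2 D : set T, countable D & dense D.

Definition linear_span (V : lmodType R[i]) (S : set V) : set V :=
  [set v | exists (k : nat) (c : 'I_k -> R[i]) (s : 'I_k -> V),
    (forall i, S (s i)) /\ v = \sum_(i < k) c i *: s i].

Definition orthonormal_basis (I : eqType) H (e : I -> H) :=
  (forall i j, '[e i, e j] = (i == j)%:R) /\ dense (linear_span (range e)).

(* K is the Hilbert space tensor product of E and F, with t x u being the
   elementary tensor of x and u; this determines (K, t) up to a unitary. *)
Definition hilbert_tensor_product E F K (t : {bilinear E -> F -> K}) :=
  (forall x y u v, '[t x u, t y v] = '[x, y] * '[u, v]) /\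
  dense (linear_span [set t x u | x in [set: E] & u in [set: F]]).

(* xget picks the operator with the stated property; it exists and is unique
   (for tensor_op, as soon as t is a Hilbert space tensor product). *)
Definition adjoint H1 H2 (S : 'B(H1, H2)) : 'B(H2, H1) :=
  xget (zero_op H2 H1)
    [set S' : 'B(H2, H1) | forall x y, '[S x, y] = '[x, S' y]].

Definition tensor_op E F K (t : {bilinear E -> F -> K})
    (A : 'B(E)) (S : 'B(F)) : 'B(K) :=
  xget (zero_op K K)
    [set P : 'B(K) | forall x u, P (t x u) = t (A x) (S u)].

End HilbertNotions.

(* The free monoid on n generators; the product is concatenation, the identity
   is [::] and the length is size. *)
Notation word n := (seq 'I_n).

Section MultiToeplitz.
Context {R : realType} {n : nat}.
Implicit Types (a : word n -> R) (m : nat) (E F K : hilbertType R).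
Implicit Types (alpha beta omega gamma : word n).

Definition positive_regular_free_holomorphic a :=
  [/\ forall alpha, 0 <= a alpha,
      a [::] = 0,
      forall i : 'I_n, 0 < a [:: i] &
      (limn_esup (fun k : nat =>
         ((\sum_(alpha : k.-tuple 'I_n) `|a alpha| ^+ 2)
            `^ ((2 * k)%:R^-1))%:E) < +oo)%E].

(* In the inner sum, gamma ranges over the j-tuples of nonempty words whose
   product is alpha; their lengths are bounded by that of alpha. *)
Definition bcoef m a alpha : R :=
  if alpha is [::] then 1 else
  \sum_(1 <= j < (size alpha).+1)
    \sum_(gamma : j.-tuple ((size alpha).-bseq 'I_n)
            | all (fun g : (size alpha).-bseq 'I_n => 0 < size g)%N gamma
              && (flatten [seq val g | g <- gamma] == alpha))
      (\prod_(g <- gamma) a g) * 'C(j + m - 1, m - 1)%:R.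

Definition weighted_left_creation m a F (e : word n -> F)
    (W : 'I_n -> 'B(F)) :=
  forall i alpha, W i (e alpha) =
    (Num.sqrt (bcoef m a alpha / bcoef m a (i :: alpha)))%:C *: e (i :: alpha).

Definition word_op F (W : 'I_n -> 'B(F)) alpha : 'B(F) :=
  foldr (fun i S => comp_op (W i) S) (id_op F) alpha.

Definition ge_r omega gamma := exists sigma, omega = sigma ++ gamma.

Definition gt_r omega gamma :=
  exists2 sigma, sigma != [::] & omega = sigma ++ gamma.

Definition r_comparable omega gamma := ge_r omega gamma \/ gt_r gamma omega.

Definition lambda m a omega gamma : R :=
  if `[< ge_r omega gamma >] then Num.sqrt (bcoef m a omega / bcoef m a gamma)
  else Num.sqrt (bcoef m a gamma / bcoef m a omega).

Definition matrix_entries E F K (t : {bilinear E -> F -> K}) (e : word n -> F)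
    (T : 'B(K)) (C : word n -> word n -> 'B(E)) :=
  forall omega gamma x y,
    '[C omega gamma x, y] = '[T (t x (e gamma)), t y (e omega)].

Definition weighted_right_multi_toeplitz m a E F K
    (t : {bilinear E -> F -> K}) (e : word n -> F) (T : 'B(K)) :=
  exists C : word n -> word n -> 'B(E),
  [/\ matrix_entries t e T C,
      forall (i : 'I_n) omega gamma, r_comparable omega gamma -> forall x,
        (lambda m a (rcons omega i) (rcons gamma i))%:C
          *: C (rcons omega i) (rcons gamma i) x
        = (lambda m a omega gamma)%:C *: C omega gamma x &
      forall alpha beta, ~ r_comparable alpha beta ->
        forall x, C alpha beta x = 0].

(* (A, B) are the coefficients of the formal Fourier representation of T; the
   value of B at the empty word plays no role. *)
Definition formal_fourier_representation m a E F K
    (t : {bilinear E -> F -> K}) (e : word n -> F) (T : 'B(K))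
    (A B : word n -> 'B(E)) :=
  (forall alpha x y, '[A alpha x, y] =
     (Num.sqrt (bcoef m a alpha))%:C * '[T (t x (e [::])), t y (e alpha)]) /\
  (forall alpha, (0 < size alpha)%N -> forall x y, '[B alpha x, y] =
     (Num.sqrt (bcoef m a alpha))%:C * '[T (t x (e alpha)), t y (e [::])]).

(* v is the vector phi(W) q, where phi(W) has coefficients (A, B); the series
   with coefficients A is summed along the net of finite sets of words. *)
Definition formal_series_value E F K (t : {bilinear E -> F -> K})
    (W : 'I_n -> 'B(F)) (A B : word n -> 'B(E)) (q v : K) :=
  let pos := fun alpha => tensor_op t (A alpha) (word_op W alpha) q in
  let neg := fun alpha => tensor_op t (B alpha) (adjoint (word_op W alpha)) q in
  finite_set [set alpha | (0 < size alpha)%N /\ neg alpha <> 0] /\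
  exists2 w : K, partial_sum pos @ totally --> w &
    v = \sum_(alpha \in [set alpha | (0 < size alpha)%N]) neg alpha + w.

End MultiToeplitz.

(* Main.v *)
(* Write C(omega, gamma) for the matrix entries of T.  Following the Toeplitz
   relation down to the empty word expresses every entry with comparable indices
   through C(sigma, 1) or C(1, sigma), i.e. through A or B; as the other entries
   vanish, (A, B) determines T.  The weights of W are such that
     (A_alpha (x) W_alpha) (h (x) e_gamma)
       = C(alpha gamma, gamma) h (x) e_(alpha gamma),
     (B_alpha (x) W_alpha^* ) (h (x) e_(alpha beta))
       = C(beta, alpha beta) h (x) e_beta,
   so applying phi(W) to h (x) e_gamma gives the expansion of T (h (x) e_gamma)
   along the basis (e_omega): the finitely many proper suffixes omega of gamma
   come from B, the words omega ending with gamma from A.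

   That the operators A (x) S exist as bounded operators rests on extension by
   density; the norm estimate on sums of elementary tensors is an instance of
   the Schur product theorem for Gram matrices. *)

Require Import Defs.
From HB Require Import structures.
From mathcomp Require Import all_boot all_order all_algebra sesquilinear.
From mathcomp Require Import finmap complex.
From mathcomp Require Import all_classical all_reals all_analysis.
From mathcomp.analysis.showcase Require Import summability.

Set Implicit Arguments.
Unset Strict Implicit.
Unset Printing Implicit Defensive.

Import Order.TTheory GRing.Theory Num.Theory Num.Def.
Import numFieldNormedType.Exports.

Local Open Scope classical_set_scope.
Local Open Scope complex_scope.
Local Open Scope ring_scope.

(** * Inner product calculus and the Cauchy-Schwarz inequality *)

Section InnerProduct.
Context {R : realType} {H : hilbertType R}.
Implicit Types (x y z u v : H) (c : R[i]).

Lemma innerC x y : '[x, y] = '[y, x]^*%R.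
Proof. by rewrite (hermC (@inner R H)) expr0 mul1r. Qed.

Lemma innerDl x y z : '[x + y, z] = '[x, z] + '[y, z].
Proof. exact: linearDl. Qed.

Lemma innerDr x y z : '[x, y + z] = '[x, y] + '[x, z].
Proof. exact: linearDr. Qed.

Lemma innerBl x y z : '[x - y, z] = '[x, z] - '[y, z].
Proof. exact: linearBl. Qed.

Lemma innerBr x y z : '[x, y - z] = '[x, y] - '[x, z].
Proof. exact: linearBr. Qed.

Lemma innerZl c x y : '[c *: x, y] = c * '[x, y].
Proof. exact: linearZl_LR. Qed.

Lemma innerZr c x y : '[x, c *: y] = c^*%R * '[x, y].
Proof. exact: linearZr_LR. Qed.

Lemma inner0l y : '[0 : H, y] = 0.
Proof. exact: linear0l. Qed.

Lemma inner0r x : '[x, 0 : H] = 0.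
Proof. exact: linear0r. Qed.

Lemma inner_suml I (r : seq I) (P : pred I) (f : I -> H) y :
  '[\sum_(i <- r | P i) f i, y] = \sum_(i <- r | P i) '[f i, y].
Proof. exact: linear_sumlz. Qed.

Lemma inner_sumr I (r : seq I) (P : pred I) (f : I -> H) x :
  '[x, \sum_(i <- r | P i) f i] = \sum_(i <- r | P i) '[x, f i].
Proof. exact: linear_sumr. Qed.

Lemma inner_eq0 x : ('[x, x] == 0) = (x == 0).
Proof. by rewrite -sqr_norm_inner expf_eq0 /= normr_eq0. Qed.

(** Nonnegativity of the squared norm of [x] minus its projection onto [y]. *)
Lemma cauchy_schwarz x y : `|'[x, y]| <= `|x| * `|y|.
Proof.
rewrite -ler_sqr ?nnegrE ?mulr_ge0 ?normr_ge0// exprMn.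
have [->|y0] := eqVneq y 0; first by rewrite inner0r !normr0 expr0n mulr0.
have yy : 0 < '[y, y] by rewrite -sqr_norm_inner exprn_gt0 ?normr_gt0.
have : 0 <= `|x - ('[x, y] / '[y, y]) *: y| ^+ 2 by rewrite exprn_ge0.
rewrite sqr_norm_inner innerBl innerZl (innerBr y) innerZr.
have -> : ('[x, y] / '[y, y])^*%R * '[y, y] = '[y, x].
  rewrite rmorphM fmorphV /= -!innerC divfK//; exact: lt0r_neq0.
rewrite subrr mulr0 subr0 innerBr innerZr rmorphM fmorphV /= -!innerC.
rewrite subr_ge0 mulrAC ler_pdivrMr// -!sqr_norm_inner (innerC y x).
by rewrite -normCKC.
Qed.

Lemma inner_ext x y : (forall z, '[x, z] = '[y, z]) -> x = y.
Proof.
move=> xy; apply/eqP; rewrite -subr_eq0 -inner_eq0 innerBl xy.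
by rewrite -innerBl subrr inner0l.
Qed.

End InnerProduct.

(** * Dense sets and linear spans *)

Section DenseSets.
Context {R : realType}.
Implicit Types (V H : normedModType R[i]).

Lemma denseP V (S : set V) :
  dense S <-> forall x eps, 0 < eps -> exists2 s, S s & `|x - s| < eps.
Proof.
split=> [dS x eps eps0|dS U [x Ux] oU].
- have [||s [xs Ss]] := dS (ball x eps).
  + by exists x; exact: ballxx.
  + exact: ball_open.
  + by exists s => //; rewrite -ball_normE in xs.
- have : nbhs x U by exact: open_nbhs_nbhs.
  rewrite -nbhs_ballE => -[eps /= eps0 xU].
  have [s Ss xs] := dS x _ eps0.
  by exists s; split => //; apply: xU; rewrite -ball_normE.
Qed.

Lemma dense_subset V (S S' : set V) : S `<=` S' -> dense S -> dense S'.
Proof.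
by move=> SS' dS U U0 oU; have [x [Ux /SS' S'x]] := dS U U0 oU; exists x.
Qed.

Lemma linear_span_min (H : hilbertType R) (S D : set H) :
  D 0 -> (forall c x y, D x -> D y -> D (c *: x + y)) ->
  S `<=` D -> linear_span S `<=` D.
Proof.
move=> D0 DD SD _ [k [c [s [Ss ->]]]].
elim/big_rec: _ => // i x _ Dx; apply: DD => //; exact: SD.
Qed.

Lemma linear_span_lin (V : lmodType R[i]) (S : set V) c x y :
  linear_span S x -> linear_span S y -> linear_span S (c *: x + y).
Proof.
move=> [k [d [s [Ss ->]]]] [k' [d' [s' [Ss' ->]]]].
exists (k + k')%N, (fun i =>
  match fintype.split i with inl j => c * d j | inr j => d' j end).
exists (fun i =>
  match fintype.split i with inl j => s j | inr j => s' j end).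
split=> [i|]; first by case: fintype.split.
rewrite big_split_ord scaler_sumr; congr (_ + _); apply: eq_bigr => i _.
- by have /= -> := unsplitK (inl i : 'I_k + 'I_k')%type; rewrite scalerA.
- by have /= -> := unsplitK (inr i : 'I_k + 'I_k')%type.
Qed.

(** The vectors approximable from [linear_span S'] form a linear subspace; containing [S], it
    contains [linear_span S], and one more approximation finishes. *)
Lemma dense_linear_span_trans (H : hilbertType R) (S S' : set H) :
  (forall v, S v -> forall eps, 0 < eps ->
    exists2 s, linear_span S' s & `|v - s| < eps) ->
  dense (linear_span S) -> dense (linear_span S').
Proof.
move=> SS' /denseP dS; apply/denseP => x eps eps0.
have e2 : 0 < eps / 2 by rewrite divr_gt0.
have SA : linear_span S `<=` [set v | forall eps, 0 < eps ->
    exists2 s, linear_span S' s & `|v - s| < eps].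
  apply: linear_span_min => //=.
    move=> d d0; exists 0; last by rewrite subrr normr0.
    exists 0%N, (fun=> 0), (fun=> 0); split=> [[]//|].
    by rewrite big_ord0.
  (* Adding 1 keeps the divisor positive when [c] is 0. *)
  move=> c u v uA vA d d0; have c0 : 0 < `|c| + 1 by rewrite ltr_wpDl.
  have [u' u'S uu'] := uA (d / 2 / (`|c| + 1)) ltac:(by rewrite !divr_gt0).
  have [v' v'S vv'] := vA (d / 2) ltac:(by rewrite !divr_gt0).
  exists (c *: u' + v'); first exact: linear_span_lin.
  rewrite opprD addrACA -scalerBr (splitr d).
  apply: le_lt_trans (ler_normD _ _) (ler_ltD _ vv').
  rewrite normrZ; apply: le_trans (ler_wpM2l _ (ltW uu')) _ => //.
  rewrite mulrCA ger_pMr ?divr_gt0// ler_pdivrMr// mul1r.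
  by rewrite lerDl.
have [s /SA/(_ _ e2)[s' s'S ss'] xs] := dS x _ e2; exists s' => //.
rewrite -(subrK s x) -addrA (splitr eps).
by apply: le_lt_trans (ler_normD _ _) (ltrD _ _).
Qed.

(** Near [x] lies a zero [s] of [f], and [f x = f (x - s)] is at most [M] times an arbitrarily small
    number. Only additivity is asked, so that [f] may be conjugate-linear, as [inner x] is. *)
Lemma dense_additive_eq0 V (S : set V) (f : V -> R[i]) (M : R[i]) :
  dense S -> 0 <= M -> (forall x y, f (x - y) = f x - f y) ->
  (forall x, `|f x| <= M * `|x|) -> (forall s, S s -> f s = 0) ->
  forall x, f x = 0.
Proof.
move=> /denseP dS M0 fB fM fS x; apply/eqP; rewrite -normr_le0.
apply/ler_addgt0Pl => eps eps0; rewrite addr0.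
have M1 : 0 < M + 1 by rewrite ltr_wpDl.
have [s Ss xs] := dS x _ (divr_gt0 eps0 M1).
rewrite -[f x]subr0 -(fS _ Ss) -fB; apply: le_trans (fM _) _.
have := ltr_pM2l M1 `|x - s| (eps / (M + 1)).
rewrite xs [X in _ < X]mulrC divfK ?gt_eqF// => /ltW; apply: le_trans.
by rewrite ler_wpM2r// lerDl.
Qed.

Lemma inner_dense_ext (H : hilbertType R) (S : set H) (x y : H) :
  dense (linear_span S) -> (forall z, S z -> '[x, z] = '[y, z]) -> x = y.
Proof.
move=> dS xy; apply: inner_ext => z; apply/eqP; rewrite -subr_eq0 -innerBl.
apply/eqP; move: z.
apply: (@dense_additive_eq0 _ _ (inner (x - y)) `|x - y|) (dS) _ _ _ _ => //.
- by move=> u v; rewrite innerBr.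
- exact: cauchy_schwarz.
- apply: linear_span_min => /= [|c z z' zp zp'|z Sz]; first exact: inner0r.
  + by rewrite innerDr innerZr zp zp' mulr0 addr0.
  + by rewrite /= innerBl xy// subrr.
Qed.

End DenseSets.

(** * Bounded operators: equality on a dense span and extension by density *)

Section BoundedExtension.
Context {R : realType}.
Implicit Types H : hilbertType R.

Lemma bounded_op_bound H1 H2 (T : 'B(H1, H2)) :
  exists2 M : R[i], 0 <= M & forall x, `|T x| <= M * `|x|.
Proof.
have /linear_bounded_continuous/linear_boundedP : continuous T.
  exact: cts_fun.
move=> [M [Mreal HM]]; exists (`|M| + 1); first by rewrite addr_ge0.
by move=> x; apply: HM; rewrite ltr_pwDr// real_ler_norm.
Qed.

(** An operator bundles a function with proofs of linearity and continuity, which are equal by proof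
    irrelevance. *)
Lemma bounded_op_ext H1 H2 (S T : 'B(H1, H2)) :
  S =1 T -> S = T.
Proof.
move=> /funext; case: S => S [[s1] [s2] [s3]].
case: T => T [[t1] [t2] [t3]] /= ST.
subst T; congr (BoundedOp.Pack (BoundedOp.Class _ _ _)); congr (_ _);
  exact: Prop_irrelevance.
Qed.

Lemma bounded_op_dense_ext H1 H2 (S T : 'B(H1, H2)) (D : set H1) :
  dense (linear_span D) -> (forall x, D x -> S x = T x) -> S = T.
Proof.
move=> dD ST; apply: bounded_op_ext => x; apply: inner_ext => y.
have [M M0 SM] := bounded_op_bound S; have [N N0 TN] := bounded_op_bound T.
apply/eqP; rewrite -subr_eq0; apply/eqP; move: x.
apply: (@dense_additive_eq0 _ _ _ (fun x => '[S x, y] - '[T x, y])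
  ((M + N) * `|y|) dD); first by rewrite mulr_ge0// addr_ge0.
- by move=> x x'; rewrite (linearB S) (linearB T) !innerBl !opprD addrACA.
- move=> x; rewrite -innerBl; apply: le_trans (cauchy_schwarz _ _) _.
  rewrite mulrAC ler_wpM2r//; apply: le_trans (ler_normB _ _) _.
  by rewrite mulrDl lerD.
- apply: linear_span_min => /= [|c x x' Sx Sx'|x Dx].
  + by rewrite (linear0 S) (linear0 T) subrr.
  + by rewrite (linearP S) (linearP T) !innerDl !innerZl opprD addrACA -mulrBr
      Sx Sx' mulr0 addr0.
  + by rewrite /= ST// subrr.
Qed.

Lemma bounded_op_of H1 H2 (f : H1 -> H2) (M : R[i]) :
  0 <= M -> linear f -> (forall x, `|f x| <= M * `|x|) ->
  exists P : 'B(H1, H2), P =1 f.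
Proof.
move=> M0 flin fM.
pose fL : {linear H1 -> H2} := HB.pack f (GRing.isLinear.Build _ _ _ _ f flin).
have fc : continuous f.
  apply: (linear_bounded_continuous fL).1; apply/linear_boundedP.
  exists M; split=> [|r Mr x]; first exact: ger0_real.
  by apply: le_trans (fM x) _; rewrite ler_wpM2r// ltW.
pose fB : 'B(H1, H2) :=
  HB.pack f (GRing.isLinear.Build _ _ _ _ f flin) (isContinuous.Build _ _ f fc).
by exists fB.
Qed.

(* The closure of a bounded linear relation with dense domain is linear and
   bounded, and total since H2 is complete: it is the graph of an operator. *)
Definition graph_closure H1 H2 (G : H1 -> H2 -> Prop) (x : H1) (y : H2) :=
  forall eps : R[i], 0 < eps ->
  exists x' y', [/\ G x' y', `|x - x'| < eps & `|y - y'| < eps].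

Section Extension.
Context {H1 H2 : hilbertType R} (G : H1 -> H2 -> Prop) (M : R[i]).
Hypothesis M0 : 0 <= M.
Hypothesis Glin : forall c x y x' y',
  G x y -> G x' y' -> G (c *: x + x') (c *: y + y').
Hypothesis Gbound : forall x y, G x y -> `|y| <= M * `|x|.
Hypothesis Gdense : dense [set x | exists y, G x y].

Let graph_closure_lin c x y x' y' : graph_closure G x y ->
  graph_closure G x' y' -> graph_closure G (c *: x + x') (c *: y + y').
Proof.
move=> Gxy Gxy' eps eps0.
have c0 : 0 < `|c| + 1 by rewrite ltr_wpDl.
have [x1 [y1 [Gxy1 xx1 yy1]]] := Gxy (eps / 2 / (`|c| + 1))
  ltac:(by rewrite !divr_gt0).
have [x2 [y2 [Gxy2 xx2 yy2]]] := Gxy' (eps / 2) ltac:(by rewrite !divr_gt0).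
exists (c *: x1 + x2), (c *: y1 + y2); split; first exact: Glin.
- rewrite opprD addrACA -scalerBr (splitr eps).
  apply: le_lt_trans (ler_normD _ _) (ler_ltD _ xx2).
  rewrite normrZ; apply: le_trans (ler_wpM2l _ (ltW xx1)) _ => //.
  rewrite mulrCA ger_pMr ?divr_gt0// ler_pdivrMr// mul1r.
  by rewrite lerDl.
- rewrite opprD addrACA -scalerBr (splitr eps).
  apply: le_lt_trans (ler_normD _ _) (ler_ltD _ yy2).
  rewrite normrZ; apply: le_trans (ler_wpM2l _ (ltW yy1)) _ => //.
  rewrite mulrCA ger_pMr ?divr_gt0// ler_pdivrMr// mul1r.
  by rewrite lerDl.
Qed.

Let graph_closure_bound x y : graph_closure G x y -> `|y| <= M * `|x|.
Proof.
move=> Gxy; apply/ler_addgt0Pr => eps eps0.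
have M1 : 0 < M + 1 by rewrite ltr_wpDl.
have [x' [y' [Gxy' xx yy]]] := Gxy (eps / (M + 1)) ltac:(by rewrite divr_gt0).
have -> : y = y' + (y - y') by rewrite addrC subrK.
apply: le_trans (ler_normD _ _) _.
apply: le_trans (lerD (Gbound Gxy') (ltW yy)) _.
have xx' : `|x'| <= `|x| + eps / (M + 1).
  have -> : x' = x - (x - x') by rewrite subKr.
  by apply: le_trans (ler_normB _ _) _; rewrite lerD2l ltW.
apply: le_trans (lerD (ler_wpM2l M0 xx') (lexx _)) _.
rewrite mulrDr -addrA lerD2l -[X in _ + X]mul1r -mulrDl.
by rewrite mulrC divfK// gt_eqF.
Qed.

Let graph_closure_total x : exists y, graph_closure G x y.
Proof.
(* [B eps] collects the values of [G] at points within [eps] of [x]; by linearity and [Gbound] these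
   sets generate a Cauchy filter, whose limit is the value sought at [x]. *)
pose B (eps : R[i]) := [set y | exists2 x', G x' y & `|x - x'| < eps].
pose F := filter_from [set eps : R[i] | 0 < eps] B.
have B0 eps : 0 < eps -> B eps !=set0.
  move=> eps0; have [x' [y Gxy] xx] := (denseP _).1 Gdense x eps eps0.
  by exists y, x'.
have FF : ProperFilter F.
  apply: filter_from_proper => //; apply: filter_from_filter.
    by exists 1 => /=.
  (* The order of [R[i]] is partial; positive elements are real, hence comparable, which gives
     [Num.min] its usual meaning. *)
  move=> e1 e2 /= e10 e20; have e12 : (e1 >=< e2)%O.
    by rewrite real_comparable ?gtr0_real.
  exists (Num.min e1 e2) => [|y [x' Gxy]] /=.
    by rewrite comparable_lt_min// e10 e20.
  by rewrite comparable_lt_min// => /andP[xe1 xe2]; split; exists x'.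
have : cvg F.
  apply/cauchy_cvgP/cauchy_exP => eps eps0.
  have M1 : 0 < M + 1 by rewrite ltr_wpDl.
  (* Two points this close to [x] are less than [eps / (M + 1)] apart, so their values are less than
     [eps] apart; the added 1 guards against [M = 0]. *)
  have e20 : 0 < eps / (M + 1) / 2 by rewrite !divr_gt0.
  have [y [x' Gxy xx]] := B0 _ e20.
  exists y; exists (eps / (M + 1) / 2) => //= z [x2 Gxz xx2].
  rewrite -ball_normE /=.
  have := Gbound (Glin (-1) Gxz Gxy).
  rewrite !scaleN1r ![- _ + _]addrC => /le_lt_trans; apply.
  have {}xx : `|x' - x2| < eps / (M + 1).
    rewrite -[x'](subrK x) -addrA (splitr (eps / (M + 1))).
    apply: le_lt_trans (ler_normD _ _) (ltrD _ xx2).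
    by rewrite distrC.
  have := ltr_pM2l M1 `|x' - x2| (eps / (M + 1)).
  rewrite xx [X in _ < X]mulrC divfK ?gt_eqF//; apply: le_lt_trans.
  by rewrite ler_wpM2r// lerDl.
move=> /cvg_ex[y Fy]; exists y => eps eps0.
have [e e0 eB] : F (ball y eps) by apply: Fy; exact: nbhsx_ballx.
have ee : (e >=< eps)%O by rewrite real_comparable ?gtr0_real.
have [|z [x' Gxz]] := B0 (Num.min e eps).
  by rewrite comparable_lt_min// eps0 andbT.
rewrite comparable_lt_min// => /andP[xe xeps]; exists x', z; split=> //.
have : ball y eps z by apply: eB; exists x'.
by rewrite -ball_normE.
Qed.

Lemma bounded_op_extension :
  exists P : 'B(H1, H2), forall x y, G x y -> P x = y.
Proof.
pose f x := xget 0 (graph_closure G x).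
have Gf x : graph_closure G x (f x).
  by apply: xgetPex; exact: graph_closure_total.
(* Two values over the same point differ by a value over 0, which the bound forces to vanish. *)
have Guniq x y z : graph_closure G x y -> graph_closure G x z -> y = z.
  move=> Gxy Gxz; apply/eqP; rewrite -subr_eq0 -normr_le0.
  have := graph_closure_bound (graph_closure_lin (-1) Gxz Gxy).
  by rewrite !scaleN1r addNr normr0 mulr0 addrC.
have flin : linear f.
  move=> c x x'; apply: Guniq (Gf _) _.
  exact: graph_closure_lin (Gf _) (Gf _).
have [P Pf] := bounded_op_of M0 flin (fun x => graph_closure_bound (Gf x)).
exists P => x y Gxy; rewrite Pf; apply: (Guniq x) => // eps eps0.
by exists x, y; rewrite !subrr !normr0.
Qed.

End Extension.

End BoundedExtension.

(** * Computing adjoints on a family with dense span *)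

Section Adjoint.
Context {R : realType} {H1 H2 : hilbertType R}.
Implicit Types S : 'B(H1, H2).

(** [adjoint] is a choice, so an operator satisfying the adjoint identity must first be produced.
    The vectors [r i] give its values on the dense span of the [e2 i], and boundedness extends it
    from there. *)
Lemma adjointE (I J : Type) S (e1 : J -> H1) (e2 : I -> H2) (r : I -> H1) :
  dense (linear_span (range e1)) -> dense (linear_span (range e2)) ->
  (forall j i, '[S (e1 j), e2 i] = '[e1 j, r i]) ->
  forall i, adjoint S (e2 i) = r i.
Proof.
move=> d1 d2 Sr; have [M M0 SM] := bounded_op_bound S.
have {}Sr i x : '[S x, e2 i] = '[x, r i].
  apply/eqP; rewrite -subr_eq0; apply/eqP; move: x.
  apply: (@dense_additive_eq0 _ _ _ (fun x => '[S x, e2 i] - '[x, r i])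
    (M * `|e2 i| + `|r i|) d1); first by rewrite addr_ge0// mulr_ge0.
  - by move=> x y; rewrite (linearB S) !innerBl !opprD addrACA.
  - move=> x; apply: le_trans (ler_normB _ _) _.
    apply: le_trans (lerD (cauchy_schwarz _ _) (cauchy_schwarz _ _)) _.
    rewrite mulrDl [X in _ <= _ + X]mulrC lerD2r mulrAC.
    by rewrite ler_wpM2r.
  - apply: linear_span_min => /= [|c x y Sx Sy|_ [j _ <-]].
    + by rewrite (linear0 S) !inner0l subrr.
    + by rewrite (linearP S) !innerDl !innerZl opprD addrACA -mulrBr Sx Sy
        mulr0 addr0.
    + by rewrite /= Sr subrr.
(* The graph of the adjoint, bounded because |y|^2 = <S y, v> when G v y. *)
pose G v y := forall x, '[S x, v] = '[x, y].
have [P PG] : exists P : 'B(H2, H1), forall v y, G v y -> P v = y.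
  apply: (@bounded_op_extension _ _ _ G M) => //.
  - by move=> c x y x' y' Gxy Gxy' z; rewrite !innerDr !innerZr Gxy Gxy'.
  - move=> x y Gxy; have [->|y0] := eqVneq y 0.
      by rewrite normr0 mulr_ge0.
    have y0' : 0 < `|y| by rewrite normr_gt0.
    rewrite -(ler_pM2r y0') -expr2 sqr_norm_inner -Gxy.
    have -> : '[S y, x] = `|'[S y, x]| by rewrite Gxy ger0_norm.
    apply: le_trans (cauchy_schwarz _ _) _.
    by rewrite mulrAC ler_wpM2r.
  - apply: dense_subset (d2); apply: linear_span_min.
    + by exists 0 => x; rewrite !inner0r.
    + move=> c x y [x' Gx] [y' Gy]; exists (c *: x' + y') => z.
      by rewrite !innerDr !innerZr Gx Gy.
    + by move=> _ [i _ <-]; exists (r i) => x; exact: Sr.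
have [N N0 PN] := bounded_op_bound P.
have adjP x y : '[S x, y] = '[x, P y].
  apply/eqP; rewrite -subr_eq0; apply/eqP; move: y.
  apply: (@dense_additive_eq0 _ _ _ (fun y => '[S x, y] - '[x, P y])
    (`|S x| + `|x| * N) d2); first by rewrite addr_ge0// mulr_ge0.
  - by move=> u v; rewrite (linearB P) !innerBr !opprD addrACA.
  - move=> y; apply: le_trans (ler_normB _ _) _.
    apply: le_trans (lerD (cauchy_schwarz _ _) (cauchy_schwarz _ _)) _.
    by rewrite mulrDl lerD2l -mulrA ler_wpM2l.
  - apply: linear_span_min => /= [|c u v Pu Pv|_ [i _ <-]].
    + by rewrite (linear0 P) !inner0r subrr.
    + by rewrite (linearP P) !innerDr !innerZr opprD addrACA -mulrBr Pu Pv
        mulr0 addr0.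
    + by rewrite /= (PG _ (r i)) ?Sr ?subrr// => z; exact: Sr.
have adj x y : '[S x, y] = '[x, adjoint S y].
  have := @xgetPex _ (zero_op H2 H1)
    [set S' : 'B(H2, H1) | forall x y, '[S x, y] = '[x, S' y]].
  by apply; exists P.
move=> i; apply: inner_ext => z.
by rewrite innerC -adj Sr -innerC.
Qed.

End Adjoint.

(** * Tensor products of bounded operators *)

Section TensorOperators.
Context {R : realType}.
Implicit Types E F K : hilbertType R.

(* Schur product theorem: split each vector into its component along the last
   one and the orthogonal remainder, and induct on the remainders. *)
Lemma psd_schur_gram F k (u : 'I_k -> F) (P : 'I_k -> 'I_k -> R[i]) :
  (forall c : 'I_k -> R[i],
    0 <= \sum_i \sum_j c i * (c j)^*%R * P i j) ->
  0 <= \sum_i \sum_j P i j * '[u i, u j].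
Proof.
elim: k => [|k IH] in u P *; first by rewrite big_ord0.
move=> Ppos; set u0 := u ord0.
(* If the vector [u0] of index [ord0] is 0, this quotient is 0 and [v] equals [u], so the identities
   below cover that case too. *)
pose mu i := '[u i, u0] / '[u0, u0].
pose v i := u i - mu i *: u0.
have v0 : v ord0 = 0.
  rewrite /v /mu -/u0; have [->|u00] := eqVneq u0 0.
    by rewrite scaler0 subr0.
  by rewrite divff ?inner_eq0// scale1r subrr.
have vu i : '[v i, u0] = 0.
  rewrite /v innerBl innerZl /mu; have [->|u00] := eqVneq u0 0.
    by rewrite !inner0r mulr0 subr0.
  by rewrite divfK ?inner_eq0// subrr.
have uD i : u i = v i + mu i *: u0 by rewrite subrK.
clearbody v mu.
have uE i j : '[u i, u j] = '[v i, v j] + mu i * (mu j)^*%R * '[u0, u0].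
  rewrite (uD i) (uD j) innerDl !innerDr !innerZl !innerZr vu.
  by rewrite (innerC u0 (v j)) vu conjC0 !mulr0 addr0 add0r mulrA.
under eq_bigr do under eq_bigr do rewrite uE mulrDr.
under eq_bigr do rewrite big_split.
rewrite big_split addr_ge0//=.
- rewrite big_ord_recl big1 ?add0r; last first.
    by move=> j _; rewrite v0 inner0l mulr0.
  under eq_bigr do rewrite big_ord_recl v0 inner0r mulr0 add0r.
  apply: IH => c.
  (* Extending [c] by 0 at [ord0] shows that [P] stays positive after deletion of that row and
     column. *)
  have := Ppos (fun i => oapp c 0 (unlift ord0 i)).
  rewrite big_ord_recl big1 ?add0r; last first.
    by move=> j _; rewrite unlift_none /= !mul0r.
  under eq_bigr do rewrite big_ord_recl unlift_none /= conjC0 mulr0 mul0r add0r.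
  by under eq_bigr do under eq_bigr do rewrite !liftK /=.
(* The other part is the quadratic form of [P] at [mu], times the squared norm of [u0]. *)
- under eq_bigr do under eq_bigr do rewrite mulrA [P _ _ * _]mulrC.
  under eq_bigr do rewrite -mulr_suml.
  by rewrite -mulr_suml mulr_ge0// dnorm_ge0.
Qed.

(** The matrix with entries [M ^+ 2 * '[x i, x j] - '[A (x i), A (x j)]] is positive, by the bound
    on [A] at [\sum_i c i *: x i]; the Schur product with the Gram matrix of [u] keeps it so. *)
Lemma gram_op_le E F (A : 'B(E)) (M : R[i]) k (x : 'I_k -> E) (u : 'I_k -> F) :
  0 <= M -> (forall x, `|A x| <= M * `|x|) ->
  \sum_i \sum_j '[A (x i), A (x j)] * '[u i, u j] <=
  M ^+ 2 * \sum_i \sum_j '[x i, x j] * '[u i, u j].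
Proof.
move=> M0 AM; rewrite -subr_ge0.
rewrite mulr_sumr -sumrB; under eq_bigr do rewrite mulr_sumr -sumrB.
under eq_bigr do under eq_bigr do rewrite mulrA -mulrBl.
apply: (psd_schur_gram u
  (P := fun i j => M ^+ 2 * '[x i, x j] - '[A (x i), A (x j)])) => c.
have -> : \sum_i \sum_j c i * (c j)^*%R *
    (M ^+ 2 * '[x i, x j] - '[A (x i), A (x j)]) =
    M ^+ 2 * `|\sum_i c i *: x i| ^+ 2 - `|A (\sum_i c i *: x i)| ^+ 2.
  rewrite !sqr_norm_inner (linear_sum A) !inner_suml mulr_sumr -sumrB.
  apply: eq_bigr => i _; rewrite !inner_sumr mulr_sumr -sumrB.
  apply: eq_bigr => j _.
  by rewrite !(linearZ_LR A) !innerZl !innerZr mulrBr mulrCA !mulrA.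
by rewrite subr_ge0 -exprMn ler_sqr ?nnegrE ?mulr_ge0.
Qed.

Section TensorOp.
Context {E F K : hilbertType R} (t : {bilinear E -> F -> K}).
Hypothesis ht : hilbert_tensor_product t.

Lemma inner_tensor x y u v : '[t x u, t y v] = '[x, y] * '[u, v].
Proof. by have [-> _] := ht. Qed.

Lemma norm_tensor x u : `|t x u| = `|x| * `|u|.
Proof.
apply/eqP; rewrite -(@eqrXn2 _ 2) ?mulr_ge0//.
by rewrite exprMn !sqr_norm_inner inner_tensor.
Qed.

Lemma sqr_norm_tensor_sum k (x : 'I_k -> E) (u : 'I_k -> F) :
  `|\sum_i t (x i) (u i)| ^+ 2 = \sum_i \sum_j '[x i, x j] * '[u i, u j].
Proof.
rewrite sqr_norm_inner inner_suml; apply: eq_bigr => i _.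
by rewrite inner_sumr; apply: eq_bigr => j _; rewrite inner_tensor.
Qed.

(** The operators are removed one at a time: first [A], against the Gram matrix of the [S (u i)],
    then [S], against that of the [x i]. *)
Lemma norm_tensor_op_sum (A : 'B(E)) (S : 'B(F)) (M N : R[i]) k
    (x : 'I_k -> E) (u : 'I_k -> F) :
  0 <= M -> (forall x, `|A x| <= M * `|x|) ->
  0 <= N -> (forall u, `|S u| <= N * `|u|) ->
  `|\sum_i t (A (x i)) (S (u i))| <= M * N * `|\sum_i t (x i) (u i)|.
Proof.
move=> M0 AM N0 SN; have MN : 0 <= M * N by exact: mulr_ge0.
rewrite -ler_sqr ?nnegrE ?normr_ge0 ?(mulr_ge0 MN)//.
rewrite (exprMn 2 (M * N)) (exprMn 2 M).
rewrite (sqr_norm_tensor_sum (A \o x) (S \o u)) (sqr_norm_tensor_sum x u).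
rewrite -mulrA; apply: le_trans (gram_op_le _ _ M0 AM) _.
rewrite ler_wpM2l ?exprn_ge0//.
have := gram_op_le u x N0 SN.
under eq_bigr do under eq_bigr do rewrite mulrC.
by under [X in _ <= _ * X]eq_bigr do under eq_bigr do rewrite mulrC.
Qed.

(** The operator is defined by [G] on finite sums of elementary tensors. As [G] is a relation,
    independence of the presentation of a sum is no separate check: it follows from the norm
    bound. *)
Lemma tensor_opE A S x u : tensor_op t A S (t x u) = t (A x) (S u).
Proof.
have [M M0 AM] := bounded_op_bound A; have [N N0 SN] := bounded_op_bound S.
pose G z w := exists s : seq (E * F), z = \sum_(p <- s) t p.1 p.2 /\
  w = \sum_(p <- s) t (A p.1) (S p.2).
have [P PG] : exists P : 'B(K), forall z w, G z w -> P z = w.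
  apply: (@bounded_op_extension _ _ _ G (M * N)); first exact: mulr_ge0.
  - move=> c _ _ _ _ [s [-> ->]] [s' [-> ->]].
    exists ([seq (c *: p.1, p.2) | p <- s] ++ s').
    rewrite !big_cat !big_map !scaler_sumr /=; split; congr (_ + _);
      apply: eq_bigr => p _; first by rewrite linearZl_LR.
    by rewrite linearZ linearZl_LR.
  - move=> _ _ [s [-> ->]]; rewrite 2!(big_tnth _ _ s).
    exact: norm_tensor_op_sum.
  - apply: dense_subset ht.2 => _ [k [c [s [ts ->]]]].
    have /choice[f fE] : forall i, exists p, s i = t p.1 p.2.
      by move=> i; have [y _ [v _ <-]] := ts i; exists (y, v).
    (* The scalars [c i] move into the first factor, since [G] deals with plain sums of tensors. *)
    exists (\sum_i t (A (c i *: (f i).1)) (S (f i).2)).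
    exists [seq (c i *: (f i).1, (f i).2) | i <- index_enum 'I_k].
    rewrite !big_map; split=> //; apply: eq_bigr => i _.
    by rewrite fE linearZl_LR.
have := @xgetPex _ (zero_op K K)
  [set P : 'B(K) | forall x u, P (t x u) = t (A x) (S u)].
apply; exists P => y v /=; apply: PG; exists [:: (y, v)].
by rewrite !big_seq1.
Qed.

End TensorOp.
End TensorOperators.

(** * Expansions along an orthonormal basis of the second tensor factor *)

Section TensorBasis.
Context {R : realType} {E F K : hilbertType R} (t : {bilinear E -> F -> K}).
Context {I : choiceType} (e : I -> F).
Hypotheses (ht : hilbert_tensor_product t) (he : orthonormal_basis e).

Lemma inner_tensor_basis x y i j :
  '[t x (e i), t y (e j)] = if i == j then '[x, y] else 0.
Proof.
by rewrite inner_tensor// he.1; case: eqP => _; rewrite ?mulr1 ?mulr0.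
Qed.

(** By [norm_tensor], approximating [u] by basis combinations to within [eps] divided by the norm of
    [x] plus 1 approximates [t x u] to within [eps]. *)
Lemma dense_tensor_basis :
  dense (linear_span [set t x (e i) | x in [set: E] & i in [set: I]]).
Proof.
apply: dense_linear_span_trans ht.2 => _ [x _ [u _ <-]] eps eps0.
have x0 : 0 < `|x| + 1 by rewrite ltr_wpDl.
have [_ [k [c [s [es ->]]]] us] := (denseP _).1 he.2 u _ (divr_gt0 eps0 x0).
exists (t x (\sum_(i < k) c i *: s i)).
  exists k, c, (fun i => t x (s i)); split.
    by move=> i; have [l _ <-] := es i; exists x => //; exists l.
  by rewrite linear_sumr; apply: eq_bigr => i _; rewrite linearZr_LR.
rewrite -linearBr norm_tensor//.
have := ltr_pM2l x0 `|u - \sum_(i < k) c i *: s i| (eps / (`|x| + 1)).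
rewrite us [X in _ < X]mulrC divfK ?gt_eqF//; apply: le_lt_trans.
by rewrite ler_wpM2r// lerDl.
Qed.

(* The error at a finite set A is orthogonal to every basic tensor occurring in
   A or in a good approximation s of v, so it is no longer than v - s. *)
Lemma tensor_basis_expansion (J : choiceType) (j : J -> I) (d : J -> E)
    (v : K) :
  injective j ->
  (forall l y, '[v, t y (e (j l))] = '[d l, y]) ->
  (forall i y, (forall l, i <> j l) -> '[v, t y (e i)] = 0) ->
  partial_sum (fun l => t (d l) (e (j l))) @ totally --> v.
Proof.
have FF := @totally_filter J.
move=> jinj vj vi; apply/cvgrPdist_lt => eps eps0.
have [_ [k [c [s [es ->]]]] vs] := (denseP _).1 dense_tensor_basis v _ eps0.
have {es} /choice[p sE] : forall l, exists p, s l = t p.1 (e p.2).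
  by move=> l; have [y _ [i _ <-]] := es l; exists (y, i).
(* Injectivity of [j] leaves finitely many indices [l] for which [j l] occurs in the approximation;
   the finite sets considered contain them all. *)
have fA : finite_set (j @^-1` range (fun l => (p l).2)).
  apply: finite_preimage => [? ? _ _|]; first exact: jinj.
  by apply: finite_image; exact: finite_finset.
exists (fset_set (j @^-1` range (fun l => (p l).2))) => // A /= /fsubsetP sA.
set u := v - _.
have uA l y : l \in A -> '[u, t y (e (j l))] = 0.
  move=> lA; rewrite /u innerBl vj /partial_sum inner_suml.
  rewrite (bigD1 [` lA]%fset)//= big1 => [|l' l'l].
    by rewrite inner_tensor_basis eqxx addr0 subrr.
  rewrite inner_tensor_basis ifF//; apply/negbTE; apply: contra l'l.
  by move=> /eqP/jinj l'l; apply/eqP/val_inj.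
have us l : '[u, s l] = 0.
  rewrite sE; have [[l' l'E]|nl] := pselect (exists l', (p l).2 = j l').
    rewrite l'E uA//; apply: sA; rewrite in_fset_set// inE /=.
    by exists l.
  have {}nl l' : (p l).2 <> j l' by move=> ?; apply: nl; exists l'.
  rewrite /u innerBl vi// inner_suml big1 ?subrr// => l' _.
  by rewrite inner_tensor_basis ifF//; apply/negbTE/eqP => /esym/nl.
have vE : v = u + partial_sum (fun l => t (d l) (e (j l))) A by rewrite subrK.
clearbody u.
apply: le_lt_trans vs; have [->|u0] := eqVneq u 0; first by rewrite normr0.
have nu0 : 0 < `|u| by rewrite normr_gt0.
rewrite -(ler_pM2l nu0) -expr2 sqr_norm_inner.
have uS : '[u, \sum_(i < k) c i *: s i] = 0.
  by rewrite inner_sumr big1// => i _; rewrite innerZr us mulr0.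
have uP : '[u, partial_sum (fun l => t (d l) (e (j l))) A] = 0.
  by rewrite inner_sumr big1// => l _; apply: uA; exact: valP.
have -> : '[u, u] = `|'[u, v - \sum_(i < k) c i *: s i]|.
  by rewrite innerBr uS subr0 vE innerDr uP addr0 ger0_norm.
exact: cauchy_schwarz.
Qed.

End TensorBasis.

(** * Positivity of the weights *)

Section FormalFourier.
Context {R : realType} {n m : nat} {a : word n -> R}.
Hypothesis ha : positive_regular_free_holomorphic a.
Implicit Types alpha beta gamma omega sigma : word n.

Local Notation b := (bcoef m a).
Arguments bcoef : simpl never.

(** All terms are nonnegative, and the factorization of the word into single letters, which occurs
    at the largest [j], contributes a positive one. *)
Lemma bcoef_gt0 alpha : 0 < b alpha.
Proof.
have [a0 _ a1 _] := ha.
rewrite /bcoef; case: alpha => [//|i0 w0]; set w := i0 :: w0.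
have w_gt0 : (0 < size w)%N by [].
have term_ge0 j (g : j.-tuple ((size w).-bseq 'I_n)) :
    0 <= (\prod_(h <- g) a h) * 'C(j + m - 1, m - 1)%:R.
  by rewrite mulr_ge0// prodr_ge0.
rewrite big_nat_recr//= ltr_wpDl ?sumr_ge0// => [j _|]; first exact: sumr_ge0.
pose g := map_tuple (fun i => insub_bseq (size w) [:: i]) (in_tuple w).
(* [insub_bseq] falls back to the empty word when the length bound fails; since [w] is nonempty, one
   letter fits. *)
have valg i : insub_bseq (size w) [:: i] = [:: i] :> seq _.
  by rewrite /insub_bseq /insubd insubT.
have gall : all (fun h : (size w).-bseq 'I_n => 0 < size h)%N g.
  by rewrite all_map; apply/allP => i _; rewrite [X in is_true X]/= valg.
have gflat : flatten [seq val h | h <- g] == w.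
  rewrite -map_comp (eq_map (g := fun i => [:: i])); last exact: valg.
  by rewrite flatten_seq1.
rewrite (bigD1 g) ?gall//.
rewrite ltr_pwDl ?sumr_ge0//.
rewrite mulr_gt0 ?ltr0n ?bin_gt0 ?leq_sub2r ?leq_addl// big_map.
by apply: prodr_gt0 => i _; rewrite valg.
Qed.

Lemma bcoef_nil : b [::] = 1. Proof. by []. Qed.

(** * Words in the weighted creation operators and their adjoints *)

Section WeightedCreation.
Context {F : hilbertType R} {e : word n -> F} {W : 'I_n -> 'B(F)}.
Hypotheses (he : orthonormal_basis e) (hW : weighted_left_creation m a e W).

(** The weights telescope: each new letter contributes a ratio whose numerator cancels the previous
    denominator. *)
Lemma word_opE alpha beta : word_op W alpha (e beta) =
  (Num.sqrt (b beta / b (alpha ++ beta)))%:C *: e (alpha ++ beta).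
Proof.
elim: alpha => [|i alpha IH] /=.
  by rewrite divff ?gt_eqF ?bcoef_gt0// sqrtr1 scale1r.
rewrite /comp_op /= IH (linearZ_LR (W i)) /= hW scalerA -rmorphM -sqrtrM.
  by rewrite mulrA divfK// gt_eqF// bcoef_gt0.
by rewrite divr_ge0// ltW// bcoef_gt0.
Qed.

(** The entry of [word_op W alpha] at [beta] and [gamma] is nonzero only for
    [gamma = alpha ++ beta]; the weight is real, so conjugation fixes it. *)
Lemma adjoint_word_opE alpha gamma :
  adjoint (word_op W alpha) (e gamma) =
  if prefix alpha gamma then
    (Num.sqrt (b (drop (size alpha) gamma) / b gamma))%:C
      *: e (drop (size alpha) gamma)
  else 0.
Proof.
apply: (adjointE (e1 := e) (r := fun gamma => if prefix alpha gamma then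
    (Num.sqrt (b (drop (size alpha) gamma) / b gamma))%:C
      *: e (drop (size alpha) gamma)
  else 0) he.2 he.2) => {gamma} beta gamma.
rewrite word_opE innerZl he.1; case: ifPn => [/prefixP[delta ->]|pr].
  rewrite drop_size_cat// innerZr he.1 eqseq_cat// eqxx /=.
  have [->|] := eqVneq beta delta; last by rewrite !mulr0.
  by rewrite !mulr1 /= conj_Creal// complex_real.
rewrite inner0r; have -> : (alpha ++ beta == gamma) = false.
  by apply: contraNF pr => /eqP <-; exact: prefix_prefix.
by rewrite mulr0.
Qed.

End WeightedCreation.

(** * The Toeplitz relation followed down to the empty word *)

Section Toeplitz.
Context {E : hilbertType R} {C : word n -> word n -> 'B(E)}.
Hypothesis Clambda : forall (i : 'I_n) omega gamma,
  r_comparable omega gamma -> forall x,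
  (lambda m a (rcons omega i) (rcons gamma i))%:C
    *: C (rcons omega i) (rcons gamma i) x
  = (lambda m a omega gamma)%:C *: C omega gamma x.

Lemma lambda_catl sigma gamma :
  lambda m a (sigma ++ gamma) gamma = Num.sqrt (b (sigma ++ gamma) / b gamma).
Proof. by rewrite /lambda asboolT//; exists sigma. Qed.

(** [lambda] tests [ge_r] first; comparing lengths, that test succeeds here only for empty [sigma],
    where both ratios are 1. *)
Lemma lambda_catr sigma gamma :
  lambda m a gamma (sigma ++ gamma) = Num.sqrt (b (sigma ++ gamma) / b gamma).
Proof.
rewrite /lambda; case: asboolP => // -[tau /(congr1 size)].
rewrite !size_cat addnA => /eqP; rewrite -{1}[size gamma]add0n eqn_add2r.
rewrite eq_sym addn_eq0 !size_eq0 => /andP[_ /eqP ->] /=.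
by rewrite !divff// gt_eqF// bcoef_gt0.
Qed.

(** Induction on [gamma] from its last letter, as the relation appends letters on the right; at the
    empty word the weight reduces because [b [::]] is 1. *)
Lemma toeplitz_catl sigma gamma x :
  (lambda m a (sigma ++ gamma) gamma)%:C *: C (sigma ++ gamma) gamma x =
  (Num.sqrt (b sigma))%:C *: C sigma [::] x.
Proof.
elim/last_ind: gamma => [|gamma i IH].
  by rewrite lambda_catl cats0 bcoef_nil divr1.
by rewrite -rcons_cat Clambda//; left; exists sigma.
Qed.

Lemma toeplitz_catr sigma gamma x :
  (lambda m a gamma (sigma ++ gamma))%:C *: C gamma (sigma ++ gamma) x =
  (Num.sqrt (b sigma))%:C *: C [::] sigma x.
Proof.
elim/last_ind: gamma => [|gamma i IH].
  by rewrite lambda_catr cats0 bcoef_nil divr1.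
(* [gt_r] asks for a nonempty left factor, so the empty [sigma] is compared through [ge_r]. *)
rewrite -rcons_cat Clambda//; have [->|s0] := eqVneq sigma [::].
  by left; exists [::].
by right; exists sigma.
Qed.

End Toeplitz.

End FormalFourier.

(** * Additivity of the values of a formal series *)

Section FormalSeriesValue.
Context {R : realType} {n : nat} {E F K : hilbertType R}.
Context (t : {bilinear E -> F -> K}) (W : 'I_n -> 'B(F)).
Context (A B : word n -> 'B(E)).

Lemma formal_series_value0 : formal_series_value t W A B 0 0.
Proof.
split.
  rewrite (_ : [set _ | _] = set0)//; apply/seteqP; split=> // alpha [_].
  by rewrite linear0.
exists 0; last by rewrite addr0 fsbig1// => alpha _; rewrite linear0.
have FF := @totally_filter (word n).
rewrite (_ : partial_sum _ = fun=> 0); first exact: cvg_cst.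
by apply/funext => J; rewrite /partial_sum big1// => alpha _; rewrite linear0.
Qed.

(** Reduces the value on a finite sum to single basic tensors. The positive parts add as limits, the
    negative ones as finite sums. *)
Lemma formal_series_valueD q v q' v' : formal_series_value t W A B q v ->
  formal_series_value t W A B q' v' ->
  formal_series_value t W A B (q + q') (v + v').
Proof.
move=> [fq [w qw ->]] [fq' [w' qw' ->]].
set N := [set _ | _] in fq; set N' := [set _ | _] in fq'.
have ND : N `|` N' `<=` [set alpha | (0 < size alpha)%N].
  by move=> alpha [[]|[]].
have fN : finite_set (N `|` N') by rewrite finite_setU.
(* The supports at [q], [q'] and [q + q'] may differ; all three negative sums are rewritten over the
   finite union [N] with [N']. *)
have negN p : (forall alpha, ~ (N `|` N') alpha -> (0 < size alpha)%N ->
    tensor_op t (B alpha) (adjoint (word_op W alpha)) p = 0) ->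
    \sum_(alpha \in [set alpha | (0 < size alpha)%N])
      tensor_op t (B alpha) (adjoint (word_op W alpha)) p =
    \sum_(alpha \in N `|` N')
      tensor_op t (B alpha) (adjoint (word_op W alpha)) p.
  move=> p0; apply/esym/fsbig_widen => // alpha [/= alpha0 nN].
  exact: p0.
have q0 alpha : ~ (N `|` N') alpha -> (0 < size alpha)%N ->
    tensor_op t (B alpha) (adjoint (word_op W alpha)) q = 0.
  by move=> nN a0; apply: contrapT => qN; apply: nN; left.
have q'0 alpha : ~ (N `|` N') alpha -> (0 < size alpha)%N ->
    tensor_op t (B alpha) (adjoint (word_op W alpha)) q' = 0.
  by move=> nN a0; apply: contrapT => qN; apply: nN; right.
split.
  apply: sub_finite_set fN => alpha [alpha0 qq']; apply: contrapT => nN.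
  by apply: qq'; rewrite linearD/= q0// q'0// addr0.
exists (w + w').
  have FF := @totally_filter (word n).
  rewrite (_ : partial_sum _ = partial_sum
    (fun alpha => tensor_op t (A alpha) (word_op W alpha) q) \+ partial_sum
    (fun alpha => tensor_op t (A alpha) (word_op W alpha) q')).
    exact: cvgD.
  apply/funext => J; rewrite /partial_sum /= -big_split/=.
  by apply: eq_bigr => alpha _; rewrite linearD.
rewrite !negN//; last first.
  by move=> alpha nN a0; rewrite linearD/= q0// q'0// addr0.
rewrite addrACA -fsbig_split//; congr (_ + _).
by apply: eq_fsbigr => alpha _; rewrite linearD.
Qed.

End FormalSeriesValue.

(** * Fourier coefficients and the action of the series on basic tensors *)

Section FourierRepresentation.
Context {R : realType} {n m : nat} {a : word n -> R}.
Hypothesis ha : positive_regular_free_holomorphic a.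
Context {E F K : hilbertType R} {t : {bilinear E -> F -> K}} {e : word n -> F}.
Context {W : 'I_n -> 'B(F)}.
Hypotheses (he : orthonormal_basis e) (ht : hilbert_tensor_product t).
Hypothesis hW : weighted_left_creation m a e W.
Local Notation b := (bcoef m a).

Section Coefficients.
Context {T : 'B(K)} {C : word n -> word n -> 'B(E)} {A B : word n -> 'B(E)}.
Hypothesis TC : matrix_entries t e T C.
Hypothesis Clambda : forall (i : 'I_n) omega gamma,
  r_comparable omega gamma -> forall x,
  (lambda m a (rcons omega i) (rcons gamma i))%:C
    *: C (rcons omega i) (rcons gamma i) x
  = (lambda m a omega gamma)%:C *: C omega gamma x.
Hypothesis C0 : forall alpha beta, ~ r_comparable alpha beta ->
  forall x, C alpha beta x = 0.
Hypothesis TAB : formal_fourier_representation m a t e T A B.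

Lemma sqrt_bcoef_ratioK sigma gamma :
  Num.sqrt (b gamma / b sigma) * Num.sqrt (b sigma / b gamma) = 1.
Proof.
rewrite -sqrtrM ?divr_ge0 ?ltW ?bcoef_gt0// mulrA divfK ?divff ?sqrtr1//;
  by rewrite gt_eqF// bcoef_gt0.
Qed.

(** The factor on the left is the weight of [W] on basis vectors and also the inverse of the
    Toeplitz weight. This serves both the action of the series and the uniqueness claim. *)
Lemma fourier_coef_catl sigma gamma x :
  (Num.sqrt (b gamma / b (sigma ++ gamma)))%:C *: A sigma x =
  C (sigma ++ gamma) gamma x.
Proof.
have -> : A sigma x = (Num.sqrt (b sigma))%:C *: C sigma [::] x.
  by apply: inner_ext => y; rewrite TAB.1 innerZl TC.
rewrite -(toeplitz_catl Clambda sigma gamma) lambda_catl scalerA -rmorphM.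
by rewrite sqrt_bcoef_ratioK scale1r.
Qed.

Lemma fourier_coef_catr sigma gamma x : (0 < size sigma)%N ->
  (Num.sqrt (b gamma / b (sigma ++ gamma)))%:C *: B sigma x =
  C gamma (sigma ++ gamma) x.
Proof.
move=> s0; have -> : B sigma x = (Num.sqrt (b sigma))%:C *: C [::] sigma x.
  by apply: inner_ext => y; rewrite TAB.2// innerZl TC.
rewrite -(toeplitz_catr ha Clambda sigma gamma) lambda_catr// scalerA -rmorphM.
by rewrite sqrt_bcoef_ratioK scale1r.
Qed.

Lemma fourier_pos_term alpha gamma h :
  tensor_op t (A alpha) (word_op W alpha) (t h (e gamma)) =
  t (C (alpha ++ gamma) gamma h) (e (alpha ++ gamma)).
Proof.
rewrite tensor_opE// (word_opE ha hW) -fourier_coef_catl.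
by rewrite linearZr_LR linearZl_LR.
Qed.

Lemma fourier_neg_term alpha gamma h : (0 < size alpha)%N ->
  tensor_op t (B alpha) (adjoint (word_op W alpha)) (t h (e gamma)) =
  if prefix alpha gamma then
    t (C (drop (size alpha) gamma) gamma h) (e (drop (size alpha) gamma))
  else 0.
Proof.
move=> a0; rewrite tensor_opE// (adjoint_word_opE ha he hW).
case: ifPn => [/prefixP[beta ->]|_]; last by rewrite linear0r.
rewrite drop_size_cat// -fourier_coef_catr//.
by rewrite linearZr_LR linearZl_LR.
Qed.

(** The adjoint kills [e gamma] unless [alpha] is a prefix of [gamma], and the nonempty prefixes are
    the listed ones. *)
Lemma fourier_neg_supp alpha gamma h : (0 < size alpha)%N ->
  alpha \notin [seq take i gamma | i <- iota 1 (size gamma)] ->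
  tensor_op t (B alpha) (adjoint (word_op W alpha)) (t h (e gamma)) = 0.
Proof.
move=> a0; rewrite fourier_neg_term//; case: ifPn => // /prefixP[beta ->].
case/mapP; exists (size alpha); last by rewrite take_size_cat.
by rewrite mem_iota a0 add1n ltnS size_cat leq_addr.
Qed.

(** Reindexing by the length [i] of the prefix removed from [gamma]; distinct lengths give distinct
    prefixes. *)
Lemma fourier_neg_sum gamma h :
  \sum_(alpha \in [set alpha | (0 < size alpha)%N])
    tensor_op t (B alpha) (adjoint (word_op W alpha)) (t h (e gamma)) =
  \sum_(i <- iota 1 (size gamma))
    t (C (drop i gamma) gamma h) (e (drop i gamma)).
Proof.
have szt i : i \in iota 1 (size gamma) -> size (take i gamma) = i.
  by rewrite mem_iota add1n ltnS => /andP[_ /size_takel].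
rewrite -(fsbig_widen [set` [seq take i gamma | i <- iota 1 (size gamma)]]).
- rewrite -fsbig_seq ?big_map.
    rewrite big_seq [RHS]big_seq; apply: eq_bigr => i ig.
    rewrite fourier_neg_term; last first.
      by rewrite szt//; move: ig; rewrite mem_iota; case/andP.
    by rewrite szt// -{2}(cat_take_drop i gamma) prefix_prefix.
  rewrite map_inj_in_uniq ?iota_uniq// => i j ig jg /(congr1 size).
  by rewrite !szt.
- move=> _ /= /mapP[i ig ->]; rewrite szt//.
  by move: ig; rewrite mem_iota => /andP[].
- by move=> alpha [/= a0 /negP]; exact: fourier_neg_supp.
Qed.

Lemma formal_series_value_tensor gamma h :
  formal_series_value t W A B (t h (e gamma)) (T (t h (e gamma))).
Proof.
split.
  apply: sub_finite_set (finite_seq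
    [seq take i gamma | i <- iota 1 (size gamma)]) => alpha [a0 nz] /=.
  by apply: contrapT => /negP ar; apply: nz; exact: fourier_neg_supp.
rewrite fourier_neg_sum; set s := \sum_(i <- _) _.
(* The limit of the positive part is forced: it is what remains of the image under [T] once [s] is
   removed. *)
exists (T (t h (e gamma)) - s); last by rewrite addrC subrK.
rewrite (_ : (fun alpha => _) =
    fun alpha => t (C (alpha ++ gamma) gamma h) (e (alpha ++ gamma))).
  2: by apply/funext => alpha; exact: fourier_pos_term.
have sE y omega : '[s, t y (e omega)] = \sum_(i <- iota 1 (size gamma))
    if drop i gamma == omega then '[C (drop i gamma) gamma h, y] else 0.
  by rewrite inner_suml; apply: eq_bigr => i _; exact: inner_tensor_basis.
apply: (tensor_basis_expansion ht he (j := fun alpha => alpha ++ gamma)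
    (d := fun alpha => C (alpha ++ gamma) gamma h)).
- move=> alpha beta ab; move/(congr1 size)/eqP: (ab).
  rewrite !size_cat eqn_add2r => /eqP sab.
  by move/eqP: ab; rewrite eqseq_cat// => /andP[/eqP].
(* The words occurring in [s] are shorter than [gamma], so [s] is orthogonal to every tensor at
   [l ++ gamma]. *)
- move=> l y; rewrite innerBl -TC sE big_seq big1 ?subr0// => i.
  rewrite mem_iota add1n ltnS => /andP[i0 ig]; case: eqP => // /(congr1 size).
  rewrite size_drop size_cat => /eqP; rewrite eqn_leq => /andP[_].
  move=> /(leq_trans (leq_addl _ _)).
  by rewrite leqNgt -subn_gt0 subKn// i0.
- move=> omega y nl; rewrite innerBl -TC sE.
  (* If [omega] is a proper suffix of [gamma], exactly one term of [s] sits at [omega], the one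
     indexed by the length of [sigma], and it cancels the entry of [T]. *)
  have [[sigma s0 gE]|ngt] := pselect (gt_r gamma omega).
    have szs : size sigma \in iota 1 (size gamma).
      by rewrite mem_iota add1n ltnS gE size_cat leq_addr lt0n size_eq0 s0.
    rewrite (bigD1_seq (size sigma)) ?iota_uniq//= big_seq_cond big1.
      have -> : drop (size sigma) gamma = omega by rewrite gE drop_size_cat.
      by rewrite eqxx addr0 subrr.
    move=> i; rewrite mem_iota add1n ltnS => /andP[/andP[i0 ig] isz].
    case: eqP => // /(congr1 size); rewrite size_drop => go.
    case/eqP: isz; rewrite -(subKn ig) go {1}gE size_cat.
    by rewrite addnK.
  (* Otherwise [omega] and [gamma] are not comparable: the entry vanishes and no term of [s] sits at
     [omega]. *)
  rewrite C0; last by case=> [[sigma /nl]|/ngt].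
  rewrite inner0l big_seq big1 ?subr0// => i; rewrite mem_iota add1n ltnS.
  move=> /andP[i0 ig]; case: eqP => // ge; case: ngt.
  exists (take i gamma); last by rewrite -ge cat_take_drop.
  by rewrite -size_eq0 size_takel// -lt0n.
Qed.

End Coefficients.

Lemma formal_fourier_representation_exists T (C : word n -> word n -> 'B(E)) :
  matrix_entries t e T C ->
  exists A B, formal_fourier_representation m a t e T A B.
Proof.
move=> TC.
(* The coefficients are the entries in the first column and first row of [T], rescaled by square
   roots of the weights. *)
have scale_op c (S : 'B(E)) : exists S' : 'B(E), forall x, S' x = c *: S x.
  have [M M0 SM] := bounded_op_bound S.
  apply: (@bounded_op_of _ _ _ (fun x => c *: S x) (`|c| * M)).
  - exact: mulr_ge0.
  - move=> k x y; rewrite (linearP S) scalerDr !scalerA.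
    by rewrite mulrC.
  - by move=> x; rewrite normrZ -mulrA ler_wpM2l.
have /choice[A AE] alpha := scale_op (Num.sqrt (b alpha))%:C (C alpha [::]).
have /choice[B BE] alpha := scale_op (Num.sqrt (b alpha))%:C (C [::] alpha).
exists A, B; split=> [alpha x y|alpha _ x y].
- by rewrite AE innerZl TC.
- by rewrite BE innerZl TC.
Qed.

End FourierRepresentation.

Theorem theorem2p2 (R : realType) (n m : nat) (hn : (1 <= n)%N) (hm : (1 <= m)%N)
    (E : hilbertType R) (E_separable : separable E)
    (a : word n -> R) (ha : positive_regular_free_holomorphic a)
    (F : hilbertType R) (e : word n -> F) (he : orthonormal_basis e)
    (K : hilbertType R) (t : {bilinear E -> F -> K})
    (ht : hilbert_tensor_product t)
    (W : 'I_n -> 'B(F)) (hW : weighted_left_creation m a e W) :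
  (forall T : 'B(K), weighted_right_multi_toeplitz m a t e T ->
    exists A B : word n -> 'B(E),
      formal_fourier_representation m a t e T A B /\
      forall (k : nat) (h : word n -> E) (q : K),
        q = \sum_(alpha : k.-bseq 'I_n) t (h alpha) (e alpha) ->
        formal_series_value t W A B q (T q)) /\
  (forall T1 T2 : 'B(K),
    weighted_right_multi_toeplitz m a t e T1 ->
    weighted_right_multi_toeplitz m a t e T2 ->
    forall A B : word n -> 'B(E),
      formal_fourier_representation m a t e T1 A B ->
      formal_fourier_representation m a t e T2 A B ->
      T1 = T2).
Proof.
split=> [T [C [TC Clambda C0]]|].
  have [A [B TAB]] := formal_fourier_representation_exists (m := m) (a := a) TC.
  exists A, B; split=> // k h _ ->.
  (* The vectors [h alpha] are arbitrary, so additivity alone passes from basic tensors to [q]. *)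
  rewrite (linear_sum T); elim/big_rec2: _ => [|alpha v q _ qv].
    exact: formal_series_value0.
  apply: formal_series_valueD => //.
  exact: (formal_series_value_tensor ha he ht hW TC Clambda C0 TAB).
move=> T1 T2 [C1 [TC1 Clambda1 C01]] [C2 [TC2 Clambda2 C02]] A B TAB1 TAB2.
(* Comparable entries are recovered from [A] or [B], which are common to both operators; the others
   are 0. *)
have C12 omega gamma x : C1 omega gamma x = C2 omega gamma x.
  have [[[sigma ->]|[sigma s0 ->]]|nc] := pselect (r_comparable omega gamma).
  - by rewrite -(fourier_coef_catl ha TC1 Clambda1 TAB1)
      (fourier_coef_catl ha TC2 Clambda2 TAB2).
  - by rewrite -(fourier_coef_catr ha TC1 Clambda1 TAB1)
      ?(fourier_coef_catr ha TC2 Clambda2 TAB2)// lt0n size_eq0.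
  - by rewrite C01// C02.
have T12 h gamma : T1 (t h (e gamma)) = T2 (t h (e gamma)).
  apply: (inner_dense_ext (dense_tensor_basis ht he)).
  by move=> _ [y _ [omega _ <-]]; rewrite -TC1 -TC2 C12.
apply: bounded_op_dense_ext (dense_tensor_basis ht he) _.
by move=> _ [h _ [gamma _ <-]].
Qed.
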